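(* Let $(M,F)$ be a conic pseudo-Finsler surface and let $\overline F=e^{\phi}F$ be a proper anisotropic conformal change of $F$. The change is vertical $C$-anisotropic if and only if $F$ is Riemannian. Moreover, the change is vertical $\overline C$-anisotropic if and only if $\overline F$ is Riemannian.
   Context: $M$ is a smooth 2-dimensional manifold with local coordinates $(x^i)$ and induced coordinates $(x^i,y^i)$ on $TM$; $\partial_i=\partial/\partial x^i$, $\dot\partial_i=\partial/\partial y^i$. $\mathcal A\subset TM_0=TM\setminus(0)$ is a conic sub-bundle (non-empty, open, invariant under $y\mapsto\lambda y$, $\lambda>0$, projecting onto $M$). A function is $h(r)$ if it is positively homogeneous of degree $r$ in $y$. A conic pseudo-Finsler metric is a smooth $h(1)$ function $F:\mathcal A\to\mathbb R$ with $g_{ij}=\frac12\dot\partial_i\dot\partial_jF^2$ non-degenerate. Modified Berwald frame: $\ell_i=\dot\partial_iF$, $\ell^i=y^i/F$, $g_{ij}=\ell_i\ell_j+\varepsilon m_im_j$ with $\varepsilon=\pm1$, $m^i=g^{ij}m_j$. The main scalar $\mathcal I$ is defined by $FC_{ijk}=\mathcal I m_im_jm_k$, where $C_{ijk}=\frac12\dot\partial_kg_{ij}$ is the Cartan tensor; $C^i_{jk}=g^{ir}C_{rjk}$; $F$ is Riemannian iff $\mathcal I=0$. For smooth $f$ on $\mathcal A$: $F\dot\partial_if=f_{;1}\ell_i+f_{;2}m_i$. An anisotropic conformal change of $F$ is $\overline F=e^{\phi(x,y)}F$ with $\phi$ a smooth $h(0)$ function on $\mathcal A$ such that $\varepsilon+\sigma-(\phi_{;2})^2\ne0$,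 where $\sigma=\phi_{;2;2}+\varepsilon\mathcal I\phi_{;2}+2(\phi_{;2})^2$. It is proper if $\phi_{;2}\neq0$. With $\rho=\frac{1}{\sigma+\varepsilon-(\phi_{;2})^2}$, the frame of $\overline F$ is taken with the same sign $\varepsilon$, $\overline m_i=e^{\phi}\sqrt{\varepsilon/\rho}\,m_i$; bars denote objects associated with $\overline F$. A proper anisotropic conformal change is vertical $C$-anisotropic conformal if $(\dot\partial_i\phi)C^i_{jk}=0$, and vertical $\overline C$-anisotropic conformal if $(\dot\partial_i\phi)\overline C^i_{jk}=0$. *)

(* Defs.v *)
From HB Require Import structures.
From mathcomp Require Import all_boot all_order all_algebra.
From mathcomp Require Import all_classical all_reals all_analysis.

Set Implicit Arguments.
Unset Strict Implicit.
Unset Printing Implicit Defensive.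

Import Order.TTheory GRing.Theory Num.Theory.
Import numFieldNormedType.Exports.

Local Open Scope classical_set_scope.
Local Open Scope ring_scope.

(* C^oo on an open set U: every iterated directional derivative of f is
   (Frechet) differentiable, hence continuous, at every point of U. *)
Definition smooth_on (R : realType) (V W : normedModType R) (U : set V)
    (f : V -> W) : Prop :=
  forall (s : seq V) (x : V), U x ->
    differentiable (foldr (fun v (g : V -> W) => 'D_v g) f s) x.

(* A smooth 2-manifold given by an atlas. [chart i] is meaningful only on
   [chart_dom i], and its inverse [par i] only on [chart i @` chart_dom i]. *)
Record surface (R : realType) := Surface {
  carrier :> topologicalType;
  surface_hausdorff : hausdorff_space carrier;
  surface_second_countable : @second_countable carrier;
  chart_index : Type;
  chart_dom : chart_index -> set carrier;
  chart : chart_index -> carrier -> 'rV[R]_2;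
  par : chart_index -> 'rV[R]_2 -> carrier;
  dom_open : forall i, open (chart_dom i);
  dom_cover : forall x : carrier, exists i, chart_dom i x;
  chart_open : forall i, open (chart i @` chart_dom i);
  chartK : forall i x, chart_dom i x -> par i (chart i x) = x;
  chart_continuous : forall i x, chart_dom i x -> {for x, continuous (chart i)};
  par_continuous : forall i u, (chart i @` chart_dom i) u ->
    {for u, continuous (par i)};
  transition_smooth : forall i j,
    smooth_on (chart i @` (chart_dom i `&` chart_dom j)) (fun u => chart j (par i u))
}.

(* Induced coordinates (x, y) on TM. *)
Notation tcoord R := ('rV[R]_2 * 'rV[R]_2)%type.

(* Overlap of charts i and j, read in TM through chart i, and the induced
   change of coordinates (x, y) |-> (tau x, d tau_x y) with
   tau = chart j o par i. TM is the gluing of the sets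
   (chart i @` chart_dom i) x R^2 along these maps, so a subset of TM (resp. a
   function on a subset of TM) is a family of subsets (resp. functions),
   indexed by the charts, compatible with them. *)
Definition overlap (R : realType) (M : surface R) (i j : chart_index M) :
    set (tcoord R) :=
  [set p | (chart i @` (chart_dom i `&` chart_dom j)) p.1].

Definition ttransition (R : realType) (M : surface R) (i j : chart_index M)
    (p : tcoord R) : tcoord R :=
  let tau := fun u => chart j (par i u) in (tau p.1, 'D_(p.2) tau p.1).

Definition tset (R : realType) (M : surface R) := chart_index M -> set (tcoord R).
Definition tfun (R : realType) (M : surface R) := chart_index M -> tcoord R -> R.

Record conic_subbundle (R : realType) (M : surface R) (A : tset M) : Prop := {
  conic_dom : forall i p, A i p -> (chart i @` chart_dom i) p.1;
  conic_slit : forall i p, A i p -> p.2 != 0;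
  conic_compat : forall i j p, overlap i j p ->
    (A i p <-> A j (ttransition i j p));
  conic_nonempty : exists i, A i !=set0;
  conic_open : forall i, open (A i);
  conic_scale : forall i p (l : R), 0 < l -> A i p -> A i (p.1, l *: p.2);
  conic_proj : forall i x, (chart i @` chart_dom i) x -> exists y, A i (x, y)
}.

Record smooth_function (R : realType) (M : surface R) (A : tset M)
    (h : tfun M) : Prop := {
  function_compat : forall i j p, A i p -> overlap i j p ->
    h j (ttransition i j p) = h i p;
  function_smooth : forall i, smooth_on (A i) (h i)
}.

Definition homogeneous (R : realType) (M : surface R) (A : tset M) (r : nat)
    (h : tfun M) : Prop :=
  forall i p (l : R), 0 < l -> A i p -> h i (p.1, l *: p.2) = l ^+ r * h i p.

Section Local.
Variable R : realType.
Implicit Types (F f h : tcoord R -> R) (m : tcoord R -> 'rV[R]_2).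
Implicit Types (p : tcoord R) (a b c : 'I_2).

(* \dot\partial_a h = d h / d y^a *)
Definition dy a h : tcoord R -> R :=
  'D_((0, delta_mx 0 a) : tcoord R) h.

Definition vgrad h p : 'rV[R]_2 := \row_a dy a h p.

Definition metric F p : 'M[R]_2 :=
  \matrix_(a, b) (2^-1 * dy a (dy b (fun q => F q ^+ 2)) p).

Definition cartan F a b c p : R := 2^-1 * dy c (fun q => metric F q a b) p.

(* C^a_{bc} = g^{ar} C_{rbc} *)
Definition cartan_up F a b c p : R :=
  \sum_r invmx (metric F p) a r * cartan F r b c p.

(* The matrix with rows l_a = \dot\partial_a F and m_a. *)
Definition frame_mx F m p : 'M[R]_2 :=
  \matrix_(k, a) (if k == 0 then vgrad F p 0 a else m p 0 a).

(* The components (f_{;1}, f_{;2}) of F \dot\partial f in the basis (l, m);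
   see [vcoordP]. *)
Definition vcoord F m f p : 'rV[R]_2 :=
  (F p *: vgrad f p) *m invmx (frame_mx F m p).

Definition vd1 F m f p : R := vcoord F m f p 0 0.
Definition vd2 F m f p : R := vcoord F m f p 0 1.

Definition sigma F (eps : tcoord R -> R) m (I phi : tcoord R -> R) p : R :=
  vd2 F m (vd2 F m phi) p + eps p * I p * vd2 F m phi p
    + 2 * vd2 F m phi p ^+ 2.

End Local.

Definition conic_pseudo_finsler (R : realType) (M : surface R) (A : tset M)
    (F : tfun M) : Prop :=
  [/\ smooth_function A F, homogeneous A 1 F &
      forall i p, A i p -> metric (F i) p \in unitmx].

(* The modified Berwald frame in each chart. It is determined by F only up to
   the sign of m, so m is not required to glue between charts. The sign eps is
   automatically locally constant; it may differ between components of A. *)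
Record berwald_frame (R : realType) (M : surface R) (A : tset M) (F : tfun M)
    (eps : tfun M) (m : chart_index M -> tcoord R -> 'rV[R]_2) : Prop := {
  frame_smooth : forall i, smooth_on (A i) (m i);
  frame_sign : forall i p, A i p -> eps i p = 1 \/ eps i p = -1;
  frame_metric : forall i p, A i p -> forall a b,
    metric (F i) p a b = vgrad (F i) p 0 a * vgrad (F i) p 0 b
                         + eps i p * m i p 0 a * m i p 0 b
}.

Definition main_scalar (R : realType) (M : surface R) (A : tset M)
    (F : tfun M) (m : chart_index M -> tcoord R -> 'rV[R]_2) (I : tfun M) : Prop :=
  forall i p, A i p -> forall a b c,
    F i p * cartan (F i) a b c p = I i p * m i p 0 a * m i p 0 b * m i p 0 c.

(* The metric tensor is independent of the direction y; locally in y, since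
   the fibres of A need not be connected. *)
Definition riemannian (R : realType) (M : surface R) (A : tset M)
    (F : tfun M) : Prop :=
  forall i p, A i p ->
    \forall y \near p.2, metric (F i) (p.1, y) = metric (F i) p.

Definition conformal_change (R : realType) (M : surface R)
    (phi F : tfun M) : tfun M :=
  fun i p => expR (phi i p) * F i p.

Record anisotropic_conformal (R : realType) (M : surface R) (A : tset M)
    (F eps : tfun M) (m : chart_index M -> tcoord R -> 'rV[R]_2) (I : tfun M)
    (phi : tfun M) : Prop := {
  conformal_smooth : smooth_function A phi;
  conformal_h0 : homogeneous A 0 phi;
  conformal_nondegenerate : forall i p, A i p ->
    eps i p + sigma (F i) (eps i) (m i) (I i) (phi i) p
      - vd2 (F i) (m i) (phi i) p ^+ 2 != 0
}.

Definition proper_change (R : realType) (M : surface R) (A : tset M) (F : tfun M)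
    (m : chart_index M -> tcoord R -> 'rV[R]_2) (phi : tfun M) : Prop :=
  forall i p, A i p -> vd2 (F i) (m i) (phi i) p != 0.

Definition vertical_C (R : realType) (M : surface R) (A : tset M)
    (F phi : tfun M) : Prop :=
  forall i p, A i p -> forall b c,
    \sum_a dy a (phi i) p * cartan_up (F i) a b c p = 0.

Definition vertical_Cbar (R : realType) (M : surface R) (A : tset M)
    (F phi : tfun M) : Prop :=
  forall i p, A i p -> forall b c,
    \sum_a dy a (phi i) p * cartan_up (conformal_change phi F i) a b c p = 0.

Lemma frame_mx_unit (R : realType) (M : surface R) (A : tset M)
    (F eps : tfun M) m i p :
  conic_pseudo_finsler A F -> berwald_frame A F eps m -> A i p ->
  frame_mx (F i) (m i) p \in unitmx.
Proof.
move=> [_ _ nd] fr Aip; have := nd i p Aip.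
set P := frame_mx _ _ _.
suff -> : metric (F i) p
    = P^T *m (diag_mx (\row_k (if k == 0 then 1 else eps i p)) *m P).
  by rewrite unitmx_mul => /andP[]; rewrite unitmx_tr.
apply/matrixP => a b; rewrite (frame_metric fr Aip) !mxE.
rewrite mul_diag_mx big_ord_recl big_ord1 /P !mxE /= ?mxE /=.
by rewrite mul1r mulrCA mulrA.
Qed.

Lemma vcoordP (R : realType) (M : surface R) (A : tset M)
    (F eps : tfun M) m i p (f : tcoord R -> R) a :
  conic_pseudo_finsler A F -> berwald_frame A F eps m -> A i p ->
  F i p * dy a f p = vd1 (F i) (m i) f p * vgrad (F i) p 0 a
                     + vd2 (F i) (m i) f p * m i p 0 a.
Proof.
move=> hF fr Aip; have U := frame_mx_unit hF fr Aip.
have /rowP/(_ a) : vcoord (F i) (m i) f p *m frame_mx (F i) (m i) p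
    = F i p *: vgrad f p by rewrite /vcoord mulmxKV.
rewrite [in LHS]mxE big_ord_recl big_ord1 /vd1 /vd2.
have -> : lift ord0 ord0 = 1 :> 'I_2 by apply/val_inj.
rewrite [frame_mx _ _ _ 0 a]mxE [frame_mx _ _ _ 1 a]mxE /= => ->.
by rewrite !mxE.
Qed.

(* Main.v *)
Require Import Defs.
From mathcomp Require Import all_boot all_order all_algebra.
From mathcomp Require Import all_classical all_reals all_analysis.
From mathcomp Require Import ring lra.

Set Implicit Arguments.
Unset Strict Implicit.
Unset Printing Implicit Defensive.

Import Order.TTheory GRing.Theory Num.Theory.
Import numFieldNormedType.Exports.

Local Open Scope classical_set_scope.
Local Open Scope ring_scope.

(** Everything happens in one chart, for a smooth function [G], positively
    homogeneous of degree one in [y], without zeros, and whose matrix [g] is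
    invertible. Such a [G] is Riemannian if and only if its Cartan tensor [C]
    vanishes, as [2 C_{abc}] is the derivative of [g_{ab}] along the fibre
    ([near_cst_metricP]).

    So the point is that the contraction of the gradient of [phi] with
    [C^a_{bc}] vanishes only if [C] does ([cartan_eq0]). Fix [b] and [c] and
    let [w = g^-1 C_{bc}]. By homogeneity the gradient of [phi] kills [y], and
    by assumption it kills [w]; it is not zero, as the change is proper, and the
    fibres have dimension two, so [w] is a multiple of [y]. But [y^r C_{rbc} = 0]
    by homogeneity of [g] ([cartan_fibre]), whereas
    [y . (g y) = G ^ 2 <> 0] ([metric_fibre]); hence [w = 0] and [C = 0].

    The first equivalence is the case [G = F]; here [F] has no zeros because
    [phi_;2], which is not zero, carries a factor [F]. The second one is the case
    [G = e^phi F], which requires the matrix of the changed metric to be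
    invertible. Writing [l], [m] for the frame, [phi_2] for [phi_;2] and
    [k = eps + sigma - phi_2 ^ 2], this matrix is
    [e^(2 phi) ((l_a + phi_2 m_a)(l_b + phi_2 m_b) + k m_a m_b)]
    ([conformal_change_metric]), of determinant
    [e^(4 phi) k (l_0 m_1 - l_1 m_0) ^ 2 <> 0]. The computation rests on the
    vertical derivatives of the frame, [F d_c l_a = eps m_a m_c]
    ([dy_dy_finsler]) and [F d_c m_a = (eps I m_a - l_a) m_c] ([dy_frame]). *)

(** * Calculus *)

Lemma sum_ord2 (V : nmodType) (f : 'I_2 -> V) : \sum_a f a = f 0 + f 1.
Proof.
rewrite big_ord_recl big_ord1; congr (_ + f _); exact/val_inj.
Qed.

Lemma ord2P (a : 'I_2) : a = 0 \/ a = 1.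
Proof. by case: a => [[|[|//]] ?]; [left|right]; apply/val_inj. Qed.

Lemma det_mx22 (A : comNzRingType) (N : 'M[A]_2) :
  \det N = N 0 0 * N 1 1 - N 0 1 * N 1 0.
Proof.
rewrite (expand_det_row _ 0) sum_ord2 /cofactor !det_mx11 !mxE /=.
rewrite expr0 expr1 !mul1r mulN1r mulrN.
by do ?[congr (_ - _); congr (_ * _); congr (N _ _)|congr (N _ _)];
  apply/val_inj.
Qed.

Section Calculus.
Variables (R : realType) (V W : normedModType R).
Implicit Types (U : set V) (f g : V -> W) (p v : V).

Lemma near_eq_differentiable f g p :
  {near p, f =1 g} -> differentiable f p -> differentiable g p.
Proof.
move=> fg df; have [dfc dfE] := (diff_locallyP _ _).1 df.
have gE : g \o shift p = cst (g p) + 'd f p +o_ 0 id.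
  apply/eqaddoP => e e0.
  have /eqaddoP/(_ e e0) H := dfE.
  have fg0 : \forall h \near (0 : V), f (h + p) = g (h + p).
    move: fg; rewrite {1}(near_shift 0) => fg'.
    by apply: filterS fg' => h /=; rewrite subr0.
  apply: filterS2 H fg0 => h /= Hh fgh.
  rewrite -[(_ - _) h]/(g (h + p) - (g p + 'd f p h)).
  by rewrite -fgh -(nbhs_singleton fg).
apply/diff_locallyP; rewrite (diff_unique dfc gE); split => //.
Qed.

(** Only the restriction of [f] to the line through [p] in the direction [v]
    matters for the derivative along [v]. *)
Lemma derive_affine_line f p v (c : W) :
  (\forall k \near (0 : R), f (k *: v + p) = f p + k *: c) -> 'D_v f p = c.
Proof.
move=> H; apply: cvg_lim => //.
apply: (@cvg_trans _ ((fun=> c) @ (0 : R)^')); last exact: cvg_cst.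
apply: near_eq_cvg.
apply: filterS2 (nbhs_dnbhs H) (nbhs_dnbhs_neq (0 : R)) => k /= -> k0.
by rewrite addrAC subrr add0r scalerA mulVf ?scale1r.
Qed.

Lemma smooth_on_differentiable U f p :
  smooth_on U f -> U p -> differentiable f p.
Proof. by move=> sf; exact: (sf [::]). Qed.

Lemma smooth_on_derive U f v : smooth_on U f -> smooth_on U ('D_v f).
Proof. by move=> sf s x Ux; have := sf (rcons s v) x Ux; rewrite foldr_rcons. Qed.

Lemma open_eq_near U f g p : open U -> {in U, f =1 g} -> U p ->
  {near p, f =1 g}.
Proof.
move=> oU fg Up; have : nbhs p U by exact: open_nbhs_nbhs.
by apply: filterS => q Uq; apply: fg; rewrite inE.
Qed.

End Calculus.

Section SmoothAlgebra.
Variables (R : realType) (V : normedModType R) (U : set V).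
Implicit Types (f g : V -> R) (v : V).

(** The functions obtained from the smooth ones by sums, products and
    exponentials. This class is closed under directional derivatives up to
    equality on [U], so that its members are smooth. *)
Inductive expr_smooth : (V -> R) -> Prop :=
| ExprBase f of smooth_on U f : expr_smooth f
| ExprAdd f g of expr_smooth f & expr_smooth g :
    expr_smooth (fun x => f x + g x)
| ExprMul f g of expr_smooth f & expr_smooth g :
    expr_smooth (fun x => f x * g x)
| ExprExp f of expr_smooth f : expr_smooth (fun x => expR (f x)).

Lemma differentiable_expR_comp f x : differentiable f x ->
  differentiable (fun x => expR (f x)) x.
Proof.
move=> df; apply: (@differentiable_comp _ _ _ _ f expR) => //.
exact/derivable1_diffP/derivable_expR.
Qed.

Lemma derive_expR_comp f v x : differentiable f x ->
  'D_v (fun x => expR (f x)) x = expR (f x) * 'D_v f x.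
Proof.
move=> df.
have de : differentiable expR (f x) by exact/derivable1_diffP/derivable_expR.
rewrite deriveE; last exact: differentiable_expR_comp.
rewrite -[fun x => expR (f x)]/(expR \o f) diff_comp //=.
by rewrite -(deriveE v df) diff1E // derive1E derive_val mulrC.
Qed.

Lemma expr_smooth_differentiable f x :
  expr_smooth f -> U x -> differentiable f x.
Proof.
move=> ef Ux; elim: ef => {f} [f sf|f g _ df _ dg|f g _ df _ dg|f _ df].
- exact: smooth_on_differentiable Ux.
- exact: differentiableD.
- exact: differentiableM.
- exact: differentiable_expR_comp.
Qed.

Lemma expr_smooth_derive f v : expr_smooth f ->
  exists2 g, expr_smooth g & {in U, 'D_v f =1 g}.
Proof.
elim=> {f} [f sf|f g ef [f' ef' ff'] eg [g' eg' gg']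
           |f g ef [f' ef' ff'] eg [g' eg' gg']|f ef [f' ef' ff']].
- by exists ('D_v f) => //; apply: ExprBase; exact: smooth_on_derive.
- exists (fun x => f' x + g' x); first exact: ExprAdd.
  move=> x Ux; rewrite -ff' // -gg' // deriveD //;
    apply: diff_derivable; exact: expr_smooth_differentiable (set_mem Ux).
- exists (fun x => f x * g' x + g x * f' x).
    by apply: ExprAdd; apply: ExprMul.
  move=> x Ux; rewrite -ff' // -gg' // deriveM //;
    apply: diff_derivable; exact: expr_smooth_differentiable (set_mem Ux).
- exists (fun x => expR (f x) * f' x).
    by apply: ExprMul => //; apply: ExprExp.
  move=> x Ux; rewrite -ff' // derive_expR_comp //.
  exact: expr_smooth_differentiable (set_mem Ux).
Qed.

Lemma expr_smooth_on f : open U -> expr_smooth f -> smooth_on U f.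
Proof.
move=> oU ef s x Ux.
suff [g eg fg] : exists2 g, expr_smooth g &
    {in U, foldr (fun v (h : V -> R) => 'D_v h) f s =1 g}.
  apply: near_eq_differentiable (expr_smooth_differentiable eg Ux).
  by apply: open_eq_near oU _ Ux => y Uy; rewrite fg.
elim: s => [|v s [g eg fg]]; first by exists f.
have [g' eg' gg'] := expr_smooth_derive v eg.
exists g' => // y Uy; rewrite -gg' //=; apply: near_eq_derive.
exact: open_eq_near oU fg (set_mem Uy).
Qed.

End SmoothAlgebra.

(** * Vertical derivatives and homogeneous functions *)

Section Fibre.
Variable R : realType.
Implicit Types (f g h : tcoord R -> R) (p q : tcoord R) (a b c : 'I_2).

Lemma dyD a f g p : differentiable f p -> differentiable g p ->
  dy a (fun q => f q + g q) p = dy a f p + dy a g p.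
Proof. by move=> df dg; rewrite /dy deriveD //; exact: diff_derivable. Qed.

Lemma dyM a f g p : differentiable f p -> differentiable g p ->
  dy a (fun q => f q * g q) p = dy a f p * g p + f p * dy a g p.
Proof.
move=> df dg; rewrite /dy (deriveM (diff_derivable _) (diff_derivable _)) //.
by rewrite addrC [_ *: _]mulrC.
Qed.

Lemma dy_expR a f p : differentiable f p ->
  dy a (fun q => expR (f q)) p = expR (f p) * dy a f p.
Proof. exact: derive_expR_comp. Qed.

Lemma dyZ a (k : R) f p : differentiable f p ->
  dy a (fun q => k * f q) p = k * dy a f p.
Proof. by move=> df; rewrite /dy deriveMl //; exact: diff_derivable. Qed.

Lemma dy_coord a b p : dy a (fun q => q.2 0 b) p = (a == b)%:R.
Proof.
apply: derive_affine_line; near=> k.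
by rewrite /= !mxE eqxx /= addrC eq_sym.
Unshelve. all: by end_near.
Qed.

Lemma differentiable_fibre_coord a p :
  differentiable (fun q : tcoord R => q.2 0 a) p.
Proof.
apply: (@differentiable_comp _ _ _ _ snd (fun y : 'rV[R]_2 => y 0 a)).
  apply: linear_differentiable => q; exact: cvg_snd.
exact: differentiable_coord.
Qed.

Lemma derive_fibre f p (y : 'rV[R]_2) : differentiable f p ->
  'D_((0, y)) f p = \sum_a y 0 a * dy a f p.
Proof.
move=> df; rewrite deriveE //.
have -> : (0, y) = \sum_a y 0 a *: ((0, delta_mx 0 a) : tcoord R).
  rewrite sum_ord2; apply/pair_equal_spec; split => /=.
    by rewrite !scaler0 addr0.
  by rewrite [LHS]row_sum_delta sum_ord2.
rewrite linear_sum; apply: eq_bigr => a _.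
by rewrite linearZ /= /dy deriveE.
Qed.

End Fibre.

Section Conic.
Variables (R : realType) (U : set (tcoord R)).
Hypothesis openU : open U.
Hypothesis scaleU : forall p (l : R), 0 < l -> U p -> U (p.1, l *: p.2).
Implicit Types (f g h : tcoord R -> R) (p q : tcoord R) (a b c : 'I_2).

Lemma near_eq_dy a f g p : {in U, f =1 g} -> U p -> dy a f p = dy a g p.
Proof. by move=> fg Up; apply: near_eq_derive; exact: open_eq_near fg Up. Qed.

Let ray (k : R) p : k *: ((0, p.2) : tcoord R) + p = (p.1, (1 + k) *: p.2).
Proof. by case: p => x y; rewrite /= scalerDl scale1r addrC; congr (_, _);
  rewrite /= ?scaler0 ?addr0. Qed.

Let near_gt0 : \forall k \near (0 : R), 0 < 1 + k.
Proof.
have : - (0 : R) < 1 by rewrite oppr0.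
by move=> /Nlt_nbhsl; apply: filterS => k; lra.
Qed.

(** Euler's relations in degrees zero and one. *)
Lemma euler0 h p : differentiable h p ->
  (forall (l : R), 0 < l -> h (p.1, l *: p.2) = h p) ->
  \sum_a p.2 0 a * dy a h p = 0.
Proof.
move=> dh hh; rewrite -derive_fibre //; apply: derive_affine_line.
by apply: filterS near_gt0 => k k0; rewrite ray hh // scaler0 addr0.
Qed.

Lemma euler1 h p : differentiable h p ->
  (forall (l : R), 0 < l -> h (p.1, l *: p.2) = l * h p) ->
  \sum_a p.2 0 a * dy a h p = h p.
Proof.
move=> dh hh; rewrite -derive_fibre //; apply: derive_affine_line.
by apply: filterS near_gt0 => k k0; rewrite ray hh // mulrDl mul1r.
Qed.

(** The vertical derivatives of a homogeneous function are homogeneous, of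
    degree one less. *)
Lemma dy_scale a h p (l c : R) : 0 < l -> U p ->
  (forall q, U q -> differentiable h q) ->
  (forall q, U q -> h (q.1, l *: q.2) = c * h q) ->
  l * dy a h (p.1, l *: p.2) = c * dy a h p.
Proof.
move=> l0 Up dh hh.
rewrite -(dyZ a c (dh _ Up)).
have <- : dy a (fun q => h (q.1, l *: q.2)) p = dy a (fun q => c * h q) p.
  by apply: near_eq_dy Up => q /set_mem /hh.
have -> : dy a (fun q => h (q.1, l *: q.2)) p
    = 'D_(l *: ((0, delta_mx 0 a) : tcoord R)) h (p.1, l *: p.2).
  rewrite /dy /derive; set f1 := (fun _ => _); set f2 := (fun _ => _).
  suff -> : f1 = f2 by [].
  apply/funext => k; rewrite {}/f1 {}/f2 /=.
  congr (_ *: (h _ - _)); apply/pair_equal_spec; split => /=.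
    by rewrite !scaler0.
  by rewrite scalerDr !scalerA mulrC.
rewrite /dy !deriveE ?linearZ //; first by exact: dh _ (scaleU l0 Up).
by exact: dh _ (scaleU l0 Up).
Qed.

End Conic.

(** * The metric and Cartan tensors *)

Section Metric.
Variables (R : realType) (U : set (tcoord R)) (G : tcoord R -> R).
Hypothesis openU : open U.
Hypothesis scaleU : forall p (l : R), 0 < l -> U p -> U (p.1, l *: p.2).
Hypothesis smoothG : smooth_on U G.
Hypothesis homG :
  forall p (l : R), 0 < l -> U p -> G (p.1, l *: p.2) = l * G p.
Implicit Types (f g h : tcoord R -> R) (p q : tcoord R) (a b c : 'I_2).

Lemma smooth_on_dy f a : smooth_on U f -> smooth_on U (dy a f).
Proof. exact: smooth_on_derive. Qed.

Let dG p : U p -> differentiable G p.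
Proof. exact: smooth_on_differentiable. Qed.

Let ddG a p : U p -> differentiable (dy a G) p.
Proof. by apply: smooth_on_differentiable; exact: smooth_on_dy. Qed.

Lemma metric_dy p a b : U p ->
  metric G p a b = dy a G p * dy b G p + G p * dy a (dy b G) p.
Proof.
move=> Up; rewrite mxE.
have -> : dy a (dy b (fun q => G q ^+ 2)) p
    = dy a (fun q => 2 * (G q * dy b G q)) p.
  apply: near_eq_dy Up => // q /set_mem Uq.
  under [X in dy b X]eq_fun do rewrite expr2.
  by rewrite dyM; [ring|exact: dG..].
have dp := dG Up; have ddp := ddG b Up.
rewrite dyZ; last exact: differentiableM.
by rewrite dyM // mulKf ?pnatr_eq0.
Qed.

Lemma metric_differentiable p a b : U p ->
  differentiable (fun q => metric G q a b) p.
Proof.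
move=> Up; apply: (@near_eq_differentiable _ _ _
  (fun q => dy a G q * dy b G q + G q * dy a (dy b G) q)).
  by apply: open_eq_near Up => // q /set_mem Uq; rewrite metric_dy.
apply: differentiableD; apply: differentiableM;
  apply: smooth_on_differentiable Up => //; do ?[exact: smooth_on_dy].
by apply: smooth_on_dy; exact: smooth_on_dy.
Qed.

Lemma dy_hom0 p a (l : R) : 0 < l -> U p ->
  dy a G (p.1, l *: p.2) = dy a G p.
Proof.
move=> l0 Up; apply: (mulfI (lt0r_neq0 l0)).
by apply: (@dy_scale _ U) => // q Uq; exact: homG.
Qed.

Lemma euler_dy p a : U p -> \sum_b p.2 0 b * dy b (dy a G) p = 0.
Proof.
move=> Up; apply: euler0; first exact: ddG.
by move=> l l0; exact: dy_hom0.
Qed.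

Lemma euler_hom1 p : U p -> \sum_a p.2 0 a * dy a G p = G p.
Proof.
by move=> Up; apply: euler1 => [|l l0]; [exact: dG|exact: homG].
Qed.

Lemma metric_fibre p b : U p ->
  \sum_a p.2 0 a * metric G p a b = G p * dy b G p.
Proof.
move=> Up; have := euler_dy b Up; have := euler_hom1 Up.
rewrite !sum_ord2 !metric_dy //.
move: (dy 0 (dy b G) p) (dy 1 (dy b G) p) => e0 e1.
move: (dy b G p) (dy 0 G p) (dy 1 G p) (p.2 0 0) (p.2 0 1) => gb g0 g1 y0 y1.
move=> <- ye.
transitivity ((y0 * g0 + y1 * g1) * gb + (y0 * g0 + y1 * g1) * (y0 * e0 + y1 * e1)).
  ring.
by rewrite ye; ring.
Qed.

(** This is the derivative of [metric_fibre] along the fibre. *)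
Lemma cartan_fibre p b c : U p ->
  \sum_a p.2 0 a * cartan G a b c p = 0.
Proof.
move=> Up; rewrite /cartan sum_ord2.
have dm a := metric_differentiable a b Up.
have dy2 a := differentiable_fibre_coord a p.
have dp := dG Up; have ddp := ddG b Up.
have : dy c (fun q => q.2 0 0 * metric G q 0 b + q.2 0 1 * metric G q 1 b) p
    = dy c (fun q => G q * dy b G q) p.
  by apply: near_eq_dy Up => // q /set_mem Uq; rewrite -metric_fibre // sum_ord2.
rewrite dyD ?dyM //; [|exact: differentiableM..].
rewrite !dy_coord.
have -> : (c == 0)%:R * metric G p 0 b + p.2 0 0 * dy c (fun q => metric G q 0 b) p
  + ((c == 1)%:R * metric G p 1 b + p.2 0 1 * dy c (fun q => metric G q 1 b) p)
  = metric G p c b + (p.2 0 0 * dy c (fun q => metric G q 0 b) p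
      + p.2 0 1 * dy c (fun q => metric G q 1 b) p).
  have [->|->] := ord2P c.
  - rewrite eqxx /=; ring.
  - rewrite eqxx /=; ring.
move=> E.
have := @addrI _ _ _ _ (etrans E (etrans (esym (metric_dy c b Up)) (esym (addr0 _)))).
by move=> {}E; rewrite !(mulrCA _ 2^-1) -mulrDr E mulr0.
Qed.

(** Two vectors of the plane orthogonal to a same non-zero covector are
    parallel. *)
Lemma orthogonal_parallel (f0 f1 y0 y1 w0 w1 : R) : f0 != 0 \/ f1 != 0 ->
  y0 * f0 + y1 * f1 = 0 -> f0 * w0 + f1 * w1 = 0 -> w0 * y1 = w1 * y0.
Proof.
move=> fn fy fw; case: fn => fn; apply: (mulfI fn).
  have := congr1 ( *%R y1) fw; have := congr1 ( *%R w1) fy; lra.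
have := congr1 ( *%R y0) fw; have := congr1 ( *%R w0) fy; lra.
Qed.

Lemma parallel_orthogonal_eq0 (l0 l1 y0 y1 w0 w1 : R) :
  y0 * l0 + y1 * l1 != 0 -> w0 * y1 = w1 * y0 ->
  l0 * w0 + l1 * w1 = 0 -> w0 = 0 /\ w1 = 0.
Proof.
move=> ly wy lw; split; apply: (mulfI ly); rewrite mulr0.
  have := congr1 ( *%R l1) wy; have := congr1 ( *%R y0) lw; lra.
have := congr1 ( *%R l0) wy; have := congr1 ( *%R y1) lw; lra.
Qed.

(** If [w = g^-1 C] then [C = g w], and both [w] and [y] are orthogonal to the
    gradient of the degree-zero function [f]; hence [w] is a multiple of [y].
    As [y . C = 0] while [y . (g y) = G ^ 2], this multiple is zero. *)
Lemma cartan_eq0 p f b c : U p -> differentiable f p ->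
  (forall (l : R), 0 < l -> f (p.1, l *: p.2) = f p) ->
  metric G p \in unitmx -> G p != 0 -> vgrad f p != 0 ->
  \sum_a dy a f p * cartan_up G a b c p = 0 ->
  forall a, cartan G a b c p = 0.
Proof.
move=> Up df homf gU G0 f0 fC0.
pose C := \col_a cartan G a b c p; pose w := invmx (metric G p) *m C.
have wE a : w a 0 = cartan_up G a b c p.
  by rewrite mxE; apply: eq_bigr => r _; rewrite mxE.
have CE a : cartan G a b c p = \sum_s metric G p a s * w s 0.
  have : (metric G p *m w) a 0 = C a 0 by rewrite mulKVmx.
  by rewrite [RHS]mxE => <-; rewrite mxE.
have fw : dy 0 f p * w 0 0 + dy 1 f p * w 1 0 = 0.
  by rewrite -fC0 sum_ord2 !wE.
have fy : p.2 0 0 * dy 0 f p + p.2 0 1 * dy 1 f p = 0.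
  by rewrite -(euler0 df homf) ?sum_ord2.
have wy : w 0 0 * p.2 0 1 = w 1 0 * p.2 0 0.
  have f01 : dy 0 f p != 0 \/ dy 1 f p != 0.
    apply/orP; rewrite -negb_and; apply: contra f0 => /andP[/eqP z0 /eqP z1].
    apply/eqP/rowP => a; rewrite !mxE.
    by have [->|->] := ord2P a.
  exact: orthogonal_parallel f01 fy fw.
have yC := cartan_fibre b c Up.
have lw : dy 0 G p * w 0 0 + dy 1 G p * w 1 0 = 0.
  apply: (mulfI G0); rewrite mulr0 -yC sum_ord2 !CE !sum_ord2.
  have m0 := metric_fibre 0 Up; have m1 := metric_fibre 1 Up.
  rewrite mulrDr !mulrA -m0 -m1 !sum_ord2.
  move: (metric G p) (w 0 0) (w 1 0) (p.2 0 0) (p.2 0 1) => g w0 w1 y0 y1; ring.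
have ly : p.2 0 0 * dy 0 G p + p.2 0 1 * dy 1 G p != 0.
  by have := euler_hom1 Up; rewrite sum_ord2 => ->.
have [w0 w1] := parallel_orthogonal_eq0 ly wy lw.
by move=> a; rewrite CE sum_ord2 w0 w1 !mulr0 addr0.
Qed.

End Metric.

(** * Functions that are locally constant along the fibres *)

Lemma is_derive_0_segment (R : realType) (g : R -> R) :
  (forall t : R, t \in `[0, 1] -> is_derive t 1 g 0) -> g 1 = g 0.
Proof.
move=> dg.
have dg' (t : R) : t \in `]0, 1[ -> is_derive t 1 g 0.
  by move=> /subset_itv_oo_cc; exact: dg.
have cg : {within `[0, 1], continuous g}.
  by apply: derivable_within_continuous => t t01; have [] := dg t t01.
have [t _] := @MVT_segment R g (fun=> 0) 0 1 ler01 dg' cg.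
by rewrite mul0r => /subr0_eq.
Qed.

Section FibreConstant.
Variables (R : realType) (U : set (tcoord R)).
Hypothesis openU : open U.
Implicit Types (f g h : tcoord R -> R) (p q : tcoord R) (a b c : 'I_2).

Lemma is_derive_line f p (v : tcoord R) (t : R) :
  differentiable f (t *: v + p) ->
  is_derive t 1 (fun t => f (t *: v + p)) ('D_v f (t *: v + p)).
Proof.
move=> df.
have E : (fun k : R => k^-1 *: (((fun t => f (t *: v + p)) \o shift t) k%:A
      - f (t *: v + p)))
    = (fun k => k^-1 *: ((f \o shift (t *: v + p)) (k *: v) - f (t *: v + p))).
  apply/funext => k /=.
  by rewrite scaler1 scalerDl addrA.
apply: DeriveDef; last by rewrite /derive E.
by have := @diff_derivable _ _ _ f _ v df; rewrite /derivable E.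
Qed.

Lemma dy_eq0_near_cst f p :
  (forall q, U q -> differentiable f q) ->
  (forall q c, U q -> dy c f q = 0) ->
  U p -> \forall y \near p.2, f (p.1, y) = f p.
Proof.
move=> df f0 Up.
have /nbhs_ballP[e /= e0 ballU] : nbhs p U by exact: open_nbhs_nbhs.
apply/nbhs_ballP; exists e => //= y.
rewrite -ball_normE /= => ye.
pose v : tcoord R := (0, y - p.2).
have vU (t : R) : t \in `[0, 1] -> U (t *: v + p).
  rewrite in_itv /= => /andP[t0 t1]; apply: ballU; split => /=.
    by rewrite scaler0 add0r; exact: ballxx.
  rewrite -ball_normE /= opprD addrCA subrr addr0 normrN normrZ ger0_norm //.
  by apply: le_lt_trans ye; rewrite distrC ler_piMl.
have dg (t : R) : t \in `[0, 1] ->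
    is_derive t 1 (fun t => f (t *: v + p)) 0.
  move=> t01; have dft := df _ (vU _ t01).
  apply: (is_derive_eq (is_derive_line dft)).
  by rewrite derive_fibre // big1 // => c _; rewrite f0 ?mulr0 //; exact: vU.
have := is_derive_0_segment dg; rewrite scale1r scale0r add0r => <-.
congr (f _); apply/pair_equal_spec; split => /=; first by rewrite add0r.
by rewrite subrK.
Qed.

Lemma near_cst_dy_eq0 f p c :
  (\forall y \near p.2, f (p.1, y) = f p) -> dy c f p = 0.
Proof.
move=> fp; apply: derive_affine_line.
pose line (k : R) : 'rV[R]_2 := k *: delta_mx 0 c + p.2.
have line0 : line 0 = p.2 by rewrite /line scale0r add0r.
have cl : {for (0 : R), continuous line} by exact: differentiable_continuous.
have lc : line k @[k --> (0 : R)] --> p.2 by rewrite -line0.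
have fl : \forall k \near (0 : R), f (p.1, line k) = f p by exact: lc fp.
apply: filterS fl => k fk; rewrite scaler0 addr0 -fk; congr (f _).
by apply/pair_equal_spec; split => //=; rewrite scaler0 add0r.
Qed.

Lemma near_cst_metricP (G : tcoord R -> R) :
  (forall p a b, U p -> differentiable (fun q => metric G q a b) p) ->
  (forall p, U p -> forall a b c, cartan G a b c p = 0) <->
  (forall p, U p -> \forall y \near p.2, metric G (p.1, y) = metric G p).
Proof.
move=> dm; split=> [C0 p Up|mc p Up a b c].
  have mc a b : \forall y \near p.2, metric G (p.1, y) a b = metric G p a b.
    apply: (@dy_eq0_near_cst (fun q => metric G q a b)) => // q *.
      exact: dm.
    apply: (mulfI (_ : (2^-1 : R) != 0)); last by rewrite mulr0; exact: C0.
    by rewrite invr_eq0 pnatr_eq0.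
  near=> y; apply/matrixP => a b.
  by have [->|->] := ord2P a; have [->|->] := ord2P b; near: y; exact: mc.
rewrite /cartan (@near_cst_dy_eq0 (fun q => metric G q a b) p c) ?mulr0 //.
by near=> y; rewrite (near (mc p Up) y).
Unshelve. all: by end_near. Qed.

End FibreConstant.

(** * The modified Berwald frame *)

Section Frame.
Variables (R : realType) (M : surface R) (A : tset M) (F eps : tfun M).
Variables (m : chart_index M -> tcoord R -> 'rV[R]_2).
Hypothesis hA : conic_subbundle A.
Hypothesis hF : conic_pseudo_finsler A F.
Hypothesis hm : berwald_frame A F eps m.
Variable i : chart_index M.
Implicit Types (f g h : tcoord R -> R) (p q : tcoord R) (a b c : 'I_2).

Let openA : open (A i). Proof. exact: conic_open. Qed.

Let scaleA p (l : R) : 0 < l -> A i p -> A i (p.1, l *: p.2).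
Proof. exact: conic_scale. Qed.

Lemma finsler_smooth : smooth_on (A i) (F i).
Proof. by case: hF => -[]. Qed.

Lemma finsler_hom p (l : R) : 0 < l -> A i p ->
  F i (p.1, l *: p.2) = l * F i p.
Proof. by case: hF => _ homF _ l0 Ap; rewrite homF ?expr1. Qed.

Let dF p : A i p -> differentiable (F i) p.
Proof. exact: smooth_on_differentiable finsler_smooth. Qed.

Let ddF a p : A i p -> differentiable (dy a (F i)) p.
Proof. exact: smooth_on_differentiable (smooth_on_dy a finsler_smooth). Qed.

Let mu a q : R := m i q 0 a.

Lemma frame_differentiable a p :
  A i p -> differentiable (fun q => m i q 0 a) p.
Proof.
move=> Ap.
apply: (@differentiable_comp _ _ _ _ (m i) (fun y : 'rV[R]_2 => y 0 a)).
  exact: smooth_on_differentiable (frame_smooth hm (i := i)) Ap.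
exact: differentiable_coord.
Qed.

Lemma frame_metric_dy p a b : A i p ->
  metric (F i) p a b
    = dy a (F i) p * dy b (F i) p + eps i p * m i p 0 a * m i p 0 b.
Proof. by move=> Ap; rewrite (frame_metric hm Ap) !mxE. Qed.

Lemma eps_sqr p : A i p -> eps i p * eps i p = 1.
Proof.
by move=> Ap; have [->|->] := frame_sign hm Ap; rewrite ?mulr1 ?mulrNN ?mulr1.
Qed.

Lemma frame_det p : A i p ->
  dy 0 (F i) p * m i p 0 1 - dy 1 (F i) p * m i p 0 0 != 0.
Proof.
move=> Ap; have := frame_mx_unit hF hm Ap.
by rewrite unitmxE det_mx22 unitfE !mxE.
Qed.

Lemma frame_neq0 p : A i p -> exists a, m i p 0 a != 0.
Proof.
move=> /frame_det D0; have [m0|] := eqVneq (m i p 0 0) 0; last by exists 0.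
have [m1|] := eqVneq (m i p 0 1) 0; last by exists 1.
by case/eqP: D0; rewrite m0 m1 !mulr0 subr0.
Qed.

(** [m] vanishes on the direction [y] itself. *)
Lemma frame_fibre p : A i p -> \sum_a p.2 0 a * m i p 0 a = 0.
Proof.
move=> Ap; have [b mb] := frame_neq0 Ap.
have e2 := eps_sqr Ap.
have := metric_fibre openA scaleA finsler_smooth finsler_hom b Ap.
have := euler_hom1 finsler_smooth finsler_hom Ap.
rewrite !sum_ord2 !(frame_metric_dy _ _ Ap).
move: (dy b (F i) p) (dy 0 (F i) p) (dy 1 (F i) p) => lb l0 l1 ly.
rewrite -ly.
move: (p.2 0 0) (p.2 0 1) (m i p 0 0) (m i p 0 1) => y0 y1 m0 m1 H.
apply: (mulIf mb); apply: (@mulfI _ (eps i p)).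
  by apply/eqP => e0; move/eqP: e2; rewrite e0 mulr0 eq_sym oner_eq0.
rewrite mul0r mulr0; move: H; lra.
Qed.

(** If [f] is constant along the rays to first order, its component [f_;1]
    vanishes. *)
Lemma dy_fibre0 p f a : F i p != 0 -> A i p ->
  \sum_a p.2 0 a * dy a f p = 0 ->
  F i p * dy a f p = vd2 (F i) (m i) f p * m i p 0 a.
Proof.
move=> F0 Ap; rewrite (vcoordP f a hF hm Ap).
have V b := vcoordP f b hF hm Ap; have := V 0; have := V 1.
have := euler_hom1 finsler_smooth finsler_hom Ap.
have := frame_fibre Ap.
rewrite !sum_ord2 !mxE => my ly V1 V0 fy.
suff -> : vd1 (F i) (m i) f p = 0 by rewrite mul0r add0r.
apply: (mulIf F0); rewrite mul0r -[in LHS]ly.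
move: V1 V0 fy my ly.
move: (vd1 _ _ _ _) (vd2 _ _ _ _) (dy 0 f p) (dy 1 f p) => v1 v2 f0 f1.
move: (dy 0 (F i) p) (dy 1 (F i) p) => l0 l1.
move: (p.2 0 0) (p.2 0 1) (m i p 0 0) (m i p 0 1) => y0 y1 m0 m1.
move=> V1 V0 fy my ly.
have := congr1 ( *%R y0) V0; have := congr1 ( *%R y1) V1.
have := congr1 ( *%R (F i p)) fy; have := congr1 ( *%R v2) my; lra.
Qed.

Let near_frame_neq0 p a : A i p -> mu a p != 0 -> \forall q \near p, mu a q != 0.
Proof.
move=> Ap ma; have /differentiable_continuous cm := frame_differentiable a Ap.
exact: (cvgr_neq0 _ cm).
Qed.

(** No regularity of [eps] is assumed; but near [p] it is equal to
    [(g_{bb} - l_b ^ 2) / m_b ^ 2] for any [b] such that [m_b] is not zero at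
    [p]. *)
Lemma eps_differentiable p : A i p -> differentiable (eps i) p.
Proof.
move=> Ap; have [b mb] := frame_neq0 Ap.
apply: (@near_eq_differentiable _ _ _ (fun q =>
  (metric (F i) q b b - dy b (F i) q * dy b (F i) q) * (mu b q * mu b q)^-1)).
  have nA : nbhs p (A i) by exact: open_nbhs_nbhs.
  apply: filterS2 nA (near_frame_neq0 Ap mb) => q Aq mq.
  rewrite (frame_metric_dy _ _ Aq) addrAC subrr add0r -[X in X * _]mulrA mulfK //.
  by rewrite mulf_neq0.
apply: differentiableM.
  apply: differentiableB; last by apply: differentiableM; exact: ddF.
  exact: (metric_differentiable openA finsler_smooth).
apply: differentiableV; last by rewrite mulf_neq0.
by apply: differentiableM; exact: frame_differentiable.
Qed.

(** This follows from [eps ^ 2 = 1]. *)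
Lemma dy_eps p c : A i p -> dy c (eps i) p = 0.
Proof.
move=> Ap; have de := eps_differentiable Ap.
have : dy c (fun q => eps i q * eps i q) p = dy c (fun=> 1) p.
  by apply: (near_eq_dy openA) Ap => q /set_mem Aq; rewrite eps_sqr.
rewrite dyM // [RHS]derive_cst => e.
have : (2 * eps i p) * dy c (eps i) p = 0 by rewrite -e; ring.
move/eqP; rewrite !mulf_eq0 pnatr_eq0 /= => /orP[/eqP e0|/eqP //].
by have := eps_sqr Ap; rewrite e0 mul0r => /eqP; rewrite eq_sym oner_eq0.
Qed.

Lemma dy_dy_finsler p a c : A i p ->
  F i p * dy c (dy a (F i)) p = eps i p * m i p 0 c * m i p 0 a.
Proof.
move=> Ap; have := metric_dy openA finsler_smooth c a Ap.
by rewrite (frame_metric_dy _ _ Ap) => /addrI.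
Qed.

(** A covector [x] is zero if its symmetric product with the non-zero [n] is. *)
Let cancel_frame (x : 'I_2 -> R) (n : 'I_2 -> R) : (exists a, n a != 0) ->
  (forall a b, x a * n b + n a * x b = 0) -> forall a, x a = 0.
Proof.
move=> [b nb] xn; have xb : x b = 0.
  have := xn b b; rewrite mulrC -mulrDr => /eqP.
  by rewrite mulf_eq0 (negbTE nb) /= -mulr2n mulrn_eq0 /= => /eqP.
by move=> a; have := xn a b; rewrite xb mulr0 addr0 => /eqP;
  rewrite mulf_eq0 (negbTE nb) orbF => /eqP.
Qed.

(** The vertical derivatives of the frame: with [dy_dy_finsler], the structure
    equations of the modified Berwald frame. *)
Lemma dy_frame (I : tfun M) p a c :
  main_scalar A F m I -> F i p != 0 -> A i p ->
  F i p * dy c (fun q => m i q 0 a) p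
    = (eps i p * I i p * m i p 0 a - dy a (F i) p) * m i p 0 c.
Proof.
move=> hI F0 Ap; rewrite -/(mu a).
apply/eqP; rewrite -subr_eq0; apply/eqP.
(* Differentiating [g_{ab} = l_a l_b + eps m_a m_b] only determines the
   symmetric product of the sought difference [x] with [m]. *)
pose x a := F i p * dy c (mu a) p
  - (eps i p * I i p * m i p 0 a - dy a (F i) p) * m i p 0 c.
apply: (@cancel_frame x (mu^~ p)) a; first exact: frame_neq0.
move=> a b; rewrite /x.
have := hI i p Ap a b c; rewrite /cartan.
have -> : dy c (fun q => metric (F i) q a b) p = dy c (fun q =>
    dy a (F i) q * dy b (F i) q + eps i q * (mu a q * mu b q)) p.
  apply: (near_eq_dy openA) Ap => q /set_mem Aq.
  by rewrite (frame_metric_dy _ _ Aq) mulrA.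
have de := eps_differentiable Ap.
have da := frame_differentiable a Ap; have db := frame_differentiable b Ap.
have dda := ddF a Ap; have ddb := ddF b Ap.
have dab : differentiable (fun q => mu a q * mu b q) p by exact: differentiableM.
rewrite dyD; [|exact: differentiableM..].
rewrite (dyM c de dab) (dyM c dda ddb) (dyM c da db) (dy_eps c Ap) mul0r add0r.
have := dy_dy_finsler a c Ap; have := dy_dy_finsler b c Ap.
have := eps_sqr Ap.
rewrite -![m i p 0 _]/(mu _ p).
move: (dy c (dy a (F i)) p) (dy c (dy b (F i)) p) => la lb.
move: (dy c (mu a) p) (dy c (mu b) p) (dy a (F i) p) (dy b (F i) p) => xa xb ya yb.
move: (mu a p) (mu b p) (mu c p) (F i p) (eps i p) (I i p) => na nb nc G e J.
move=> e2 Lb La H.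
have : (e * e) * (G * (xa * nb + na * xb))
    = 2 * e * (J * na * nb * nc) - e * (ya * (G * lb) + yb * (G * la)).
  by rewrite -H; field.
rewrite La Lb e2 mul1r => E.
transitivity (G * (xa * nb + na * xb) - 2 * e * (J * na * nb * nc)
  + ya * nb * nc + na * yb * nc); first by ring.
rewrite E.
transitivity (ya * nb * nc + na * yb * nc - (e * e) * (ya * nb * nc + na * yb * nc)).
  by ring.
by rewrite e2 mul1r subrr.
Qed.

End Frame.

(** * Anisotropic conformal changes *)

Section Conformal.
Variables (R : realType) (M : surface R) (A : tset M) (F eps : tfun M).
Variables (m : chart_index M -> tcoord R -> 'rV[R]_2) (I phi : tfun M).
Hypothesis hA : conic_subbundle A.
Hypothesis hF : conic_pseudo_finsler A F.
Hypothesis hm : berwald_frame A F eps m.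
Hypothesis hI : main_scalar A F m I.
Hypothesis hphi : anisotropic_conformal A F eps m I phi.
Hypothesis hproper : proper_change A F m phi.
Variable i : chart_index M.
Implicit Types (f g h : tcoord R -> R) (p q : tcoord R) (a b c : 'I_2).

Let openA : open (A i). Proof. exact: conic_open. Qed.

Let scaleA p (l : R) : 0 < l -> A i p -> A i (p.1, l *: p.2).
Proof. exact: conic_scale. Qed.

Let smoothF : smooth_on (A i) (F i).
Proof. exact: finsler_smooth hF i. Qed.

Let smoothphi : smooth_on (A i) (phi i).
Proof. by case: (conformal_smooth hphi). Qed.

Lemma conformal_hom p (l : R) : 0 < l -> A i p ->
  phi i (p.1, l *: p.2) = phi i p.
Proof. by move=> l0 Ap; rewrite (conformal_h0 hphi) ?expr0 ?mul1r. Qed.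

Let dF p : A i p -> differentiable (F i) p.
Proof. exact: smooth_on_differentiable. Qed.

Let dphi p : A i p -> differentiable (phi i) p.
Proof. exact: smooth_on_differentiable. Qed.

Let ddF a p : A i p -> differentiable (dy a (F i)) p.
Proof. exact: smooth_on_differentiable (smooth_on_dy a smoothF). Qed.

Let ddphi a p : A i p -> differentiable (dy a (phi i)) p.
Proof. exact: smooth_on_differentiable (smooth_on_dy a smoothphi). Qed.

Let dm a p : A i p -> differentiable (fun q => m i q 0 a) p.
Proof. exact: frame_differentiable hm i a p. Qed.

Lemma finsler_neq0 p : A i p -> F i p != 0.
Proof.
move=> Ap; apply: contra (hproper Ap) => /eqP F0.
by rewrite /vd2 /vcoord F0 scale0r mul0mx mxE.
Qed.

(** [phi_2] is the component [phi_;2] of the vertical gradient of [phi]. *)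
Let phi2 : tcoord R -> R := vd2 (F i) (m i) (phi i).

Lemma conformal_dy p a : A i p ->
  F i p * dy a (phi i) p = phi2 p * m i p 0 a.
Proof.
move=> Ap; apply: (dy_fibre0 hA hF hm) => //; first exact: finsler_neq0.
apply: euler0; first exact: dphi.
by move=> l l0; exact: conformal_hom.
Qed.

Lemma conformal_vgrad_neq0 p : A i p -> vgrad (phi i) p != 0.
Proof.
move=> Ap; have [a ma] := frame_neq0 hF hm Ap.
apply/eqP => /rowP /(_ a); rewrite !mxE => pa.
have := conformal_dy a Ap; rewrite pa mulr0 => /esym/eqP.
by rewrite mulf_eq0 (negbTE ma) orbF; apply/negP; exact: hproper.
Qed.

(** [phi_2] is defined through the inverse of the frame; it is equal to
    [F phi_b / m_b] near a point where [m_b] is not zero. *)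
Let dphi2 p : A i p -> differentiable phi2 p.
Proof.
move=> Ap; have [b mb] := frame_neq0 hF hm Ap.
apply: (@near_eq_differentiable _ _ _ (fun q =>
  F i q * dy b (phi i) q * (m i q 0 b)^-1)).
  have nA : nbhs p (A i) by exact: open_nbhs_nbhs.
  have nm : \forall q \near p, m i q 0 b != 0.
    have /differentiable_continuous cm := dm b Ap.
    exact: (cvgr_neq0 _ cm).
  apply: filterS2 nA nm => q Aq mq.
  by rewrite (conformal_dy b Aq) mulfK.
apply: differentiableM; last by apply: differentiableV => //; exact: dm.
by apply: differentiableM; [exact: dF|exact: ddphi].
Qed.

Lemma dy_conformal_dy p a c : A i p ->
  dy c (fun q => F i q * dy a (phi i) q) p
    = dy c phi2 p * m i p 0 a + phi2 p * dy c (fun q => m i q 0 a) p.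
Proof.
move=> Ap; have d2 := dphi2 Ap; have da := dm a Ap.
rewrite -(dyM c d2 da).
by apply: (near_eq_dy openA) Ap => q /set_mem Aq; rewrite conformal_dy.
Qed.

(** [phi_2] is constant along the rays to first order, as [F phi_a] is, by
    homogeneity, and [m_a] is, by [dy_frame] and [frame_fibre]. *)
Lemma euler_phi2 p : A i p -> \sum_b p.2 0 b * dy b phi2 p = 0.
Proof.
move=> Ap; have [a ma] := frame_neq0 hF hm Ap.
have F0 := finsler_neq0 Ap.
have : \sum_b p.2 0 b * dy b (fun q => F i q * dy a (phi i) q) p = 0.
  apply: euler0.
    by apply: differentiableM; [exact: dF|exact: ddphi].
  move=> l l0 /=; rewrite (finsler_hom hF l0 Ap) [l * _]mulrC -mulrA.
  congr (_ * _); rewrite -[RHS]mul1r; apply: (dy_scale openA scaleA) => //.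
  by move=> q Aq; rewrite conformal_hom // mul1r.
rewrite !sum_ord2 !dy_conformal_dy //.
have D c := dy_frame hA hF hm a c hI F0 Ap.
have := D 0; have := D 1; have := frame_fibre hA hF hm Ap; rewrite sum_ord2.
move: (dy 0 (fun q => m i q 0 a) p) (dy 1 (fun q => m i q 0 a) p) => d0 d1.
move: (eps i p * I i p * m i p 0 a - dy a (F i) p) => k.
move: (dy 0 phi2 p) (dy 1 phi2 p) (phi2 p) => f0 f1 f2.
move: (p.2 0 0) (p.2 0 1) => y0 y1.
move: (m i p 0 0) (m i p 0 1) => m0 m1 my D1 D0 E.
apply: (mulIf ma); apply: (mulfI F0); rewrite mul0r mulr0.
have E' := congr1 ( *%R (F i p)) E.
have D0' := congr1 ( *%R (f2 * y0)) D0; have D1' := congr1 ( *%R (f2 * y1)) D1.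
have my' := congr1 ( *%R (f2 * k)) my; lra.
Qed.

Lemma dy_phi2 p a : A i p ->
  F i p * dy a phi2 p = vd2 (F i) (m i) phi2 p * m i p 0 a.
Proof.
move=> Ap; apply: (dy_fibre0 hA hF hm) => //; first exact: finsler_neq0.
exact: euler_phi2.
Qed.

Let Fb : tcoord R -> R := conformal_change phi F i.

Lemma conformal_change_smooth : smooth_on (A i) Fb.
Proof.
apply: expr_smooth_on => //; apply: ExprMul; last exact: ExprBase.
by apply: ExprExp; exact: ExprBase.
Qed.

Lemma conformal_change_hom p (l : R) : 0 < l -> A i p ->
  Fb (p.1, l *: p.2) = l * Fb p.
Proof.
move=> l0 Ap; rewrite /Fb /conformal_change (conformal_hom l0 Ap).
by rewrite (finsler_hom hF l0 Ap) mulrCA.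
Qed.

Lemma conformal_change_neq0 p : A i p -> Fb p != 0.
Proof.
by move=> Ap; rewrite mulf_neq0 ?finsler_neq0 // gt_eqF ?expR_gt0.
Qed.

Lemma dy_conformal_change p a : A i p ->
  dy a Fb p = expR (phi i p) * (F i p * dy a (phi i) p + dy a (F i) p).
Proof.
move=> Ap; have dp := dphi Ap; have de := differentiable_expR_comp dp.
rewrite (dyM a de (dF Ap)) dy_expR // mulrDr; congr (_ + _).
by rewrite mulrAC mulrA.
Qed.

(** The quantity whose non-vanishing makes the change non-degenerate. *)
Let kappa p : R := eps i p + sigma (F i) (eps i) (m i) (I i) (phi i) p
  - vd2 (F i) (m i) (phi i) p ^+ 2.

(** Here [kappa] arises from
    [sigma - phi_2 ^ 2 = phi_;2;2 + eps I phi_2 + phi_2 ^ 2]. *)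
Lemma dy_dy_conformal_change p a b : A i p ->
  F i p * dy a (dy b Fb) p
    = expR (phi i p) * kappa p * m i p 0 a * m i p 0 b.
Proof.
move=> Ap; have F0 := finsler_neq0 Ap.
have dp := dphi Ap; have de := differentiable_expR_comp dp.
have dFp : differentiable (fun q => F i q * dy b (phi i) q) p.
  by apply: differentiableM; [exact: dF|exact: ddphi].
have dl := ddF b Ap.
have ds : differentiable
    (fun q => F i q * dy b (phi i) q + dy b (F i) q) p by exact: differentiableD.
have -> : dy a (dy b Fb) p = dy a (fun q => expR (phi i q)
    * (F i q * dy b (phi i) q + dy b (F i) q)) p.
  by apply: (near_eq_dy openA) Ap => q /set_mem Aq; rewrite dy_conformal_change.
rewrite (dyM a de ds) (dy_expR a dp) (dyD a dFp dl).
rewrite (dy_conformal_dy b a Ap) (conformal_dy b Ap) /kappa /sigma -/phi2.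
have := conformal_dy a Ap; have := dy_phi2 a Ap.
have := dy_frame hA hF hm b a hI F0 Ap.
have := dy_dy_finsler hA hF hm b a Ap.
move: (dy a (dy b (F i)) p) (dy a (fun q => m i q 0 b) p) => lab mab.
move: (dy a phi2 p) (vd2 (F i) (m i) phi2 p) (phi2 p) => f2a f22 f2.
move: (dy a (phi i) p) (dy b (F i) p) (expR (phi i p)) => fa lb e.
move: (m i p 0 a) (m i p 0 b) (eps i p) (I i p) (F i p) => ma mb s J G.
move=> Hl Hm H2 Hf.
transitivity (e * ((G * fa) * (f2 * mb + lb)
  + (G * f2a) * mb + f2 * (G * mab) + G * lab)); first by ring.
by rewrite Hl Hm H2 Hf; ring.
Qed.

Lemma conformal_change_metric p a b : A i p ->
  metric Fb p a b = expR (phi i p) ^+ 2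
    * ((dy a (F i) p + phi2 p * m i p 0 a) * (dy b (F i) p + phi2 p * m i p 0 b)
       + kappa p * m i p 0 a * m i p 0 b).
Proof.
move=> Ap; rewrite (metric_dy openA conformal_change_smooth a b Ap).
rewrite (dy_conformal_change a Ap) (dy_conformal_change b Ap).
rewrite (conformal_dy a Ap) (conformal_dy b Ap).
rewrite -[Fb p]/(expR (phi i p) * F i p) -[_ * _ * dy a (dy b Fb) p]mulrA.
rewrite (dy_dy_conformal_change a b Ap).
move: (dy a (F i) p) (dy b (F i) p) (m i p 0 a) (m i p 0 b) (phi2 p) (kappa p).
by move: (expR _) => *; ring.
Qed.

Lemma conformal_change_unit p : A i p -> metric Fb p \in unitmx.
Proof.
move=> Ap; rewrite unitmxE unitfE det_mx22 !(conformal_change_metric _ _ Ap).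
have := frame_det hF hm Ap.
have : kappa p != 0 by exact: (conformal_nondegenerate hphi).
have : expR (phi i p) != 0 by rewrite gt_eqF ?expR_gt0.
move: (dy 0 (F i) p) (dy 1 (F i) p) (m i p 0 0) (m i p 0 1) (phi2 p) (kappa p).
move: (expR _) => e l0 l1 m0 m1 f k e0 k0 D0.
rewrite (_ : _ - _ = e ^+ 4 * k * (l0 * m1 - l1 * m0) ^+ 2); last by ring.
by rewrite !mulf_neq0 ?expf_neq0.
Qed.

(** The metric [G] is arbitrary here: only [phi] is tied to [F], through which
    its vertical gradient is known not to vanish. *)
Lemma vertical_cartanP (G : tcoord R -> R) :
  smooth_on (A i) G ->
  (forall p (l : R), 0 < l -> A i p -> G (p.1, l *: p.2) = l * G p) ->
  (forall p, A i p -> metric G p \in unitmx) ->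
  (forall p, A i p -> G p != 0) ->
  (forall p, A i p -> forall b c,
     \sum_a dy a (phi i) p * cartan_up G a b c p = 0) <->
  (forall p, A i p -> \forall y \near p.2, metric G (p.1, y) = metric G p).
Proof.
move=> sG hG gU G0.
have dmG p a b : A i p -> differentiable (fun q => metric G q a b) p.
  exact: metric_differentiable.
apply: iff_trans (near_cst_metricP openA dmG).
split=> [vC p Ap a b c|C0 p Ap b c].
  apply: (cartan_eq0 openA scaleA sG hG (f := phi i)) => //.
  - exact: dphi.
  - by move=> l l0; exact: conformal_hom.
  - exact: gU.
  - exact: G0.
  - exact: conformal_vgrad_neq0.
  - exact: vC.
rewrite big1 // => a _; rewrite /cartan_up big1 ?mulr0 // => r _.
by rewrite C0 ?mulr0.
Qed.

End Conformal.

Theorem proposition3p14 (R : realType) (M : surface R) (A : tset M)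
    (F eps : tfun M) (m : chart_index M -> tcoord R -> 'rV[R]_2) (I phi : tfun M)
    (hA : conic_subbundle A)
    (hF : conic_pseudo_finsler A F)
    (hm : berwald_frame A F eps m)
    (hI : main_scalar A F m I)
    (hphi : anisotropic_conformal A F eps m I phi)
    (hproper : proper_change A F m phi) :
  (vertical_C A F phi <-> riemannian A F) /\
  (vertical_Cbar A F phi <-> riemannian A (conformal_change phi F)).
Proof.
have P i := vertical_cartanP hA hF hm hphi hproper (i := i).
have PF i : (forall p, A i p -> forall b c,
      \sum_a dy a (phi i) p * cartan_up (F i) a b c p = 0) <->
    (forall p, A i p ->
      \forall y \near p.2, metric (F i) (p.1, y) = metric (F i) p).
  apply: P.
  - exact: finsler_smooth hF i.
  - by move=> p l; exact: finsler_hom hF i p l.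
  - by case: hF => _ _ gU p; exact: gU.
  - by move=> p; exact: finsler_neq0 hproper i p.
have PG i : (forall p, A i p -> forall b c,
      \sum_a dy a (phi i) p * cartan_up (conformal_change phi F i) a b c p = 0)
    <-> (forall p, A i p -> \forall y \near p.2,
      metric (conformal_change phi F i) (p.1, y)
        = metric (conformal_change phi F i) p).
  apply: P.
  - exact: conformal_change_smooth hA hF hphi i.
  - by move=> p l; exact: conformal_change_hom hF hphi i p l.
  - by move=> p; exact: conformal_change_unit hA hF hm hI hphi hproper i p.
  - by move=> p; exact: conformal_change_neq0 hproper i p.
by split; split=> H i; [exact: ((PF i).1 (H i))|exact: ((PF i).2 (H i))
                       |exact: ((PG i).1 (H i))|exact: ((PG i).2 (H i))].
Qed.
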